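(* For every $r=3t-1$ with $r=26$ or $r\ge44$ (i.e. $t=9$ or $t\ge15$), there exists a binary linear $[n,n-r,3]_2 3,2$ code with $n=819\cdot2^{(r-26)/3}-1$. Consequently $\ell_2(r,3)\le 819\cdot2^{(r-26)/3}-1$ for these $r$, and the covering densities $\mu=2^{-r}\sum_{i=0}^{3}\binom ni$ of these codes tend to $819^3/(3\cdot2^{27})\approx1.3643$ as $r\to\infty$.
   Context: An $[n,n-r,d]_2R,\ell$ code is a binary linear code of length $n$, codimension $r$, minimum distance $d$, covering radius $R$ (smallest $R$ such that every vector of $\mathbb{F}_2^r$ is a sum of at most $R$ columns of a parity-check matrix $H$), such that some parity-check matrix $H$ admits an $(R,\ell)$-partition: a partition of its columns into nonempty subsets such that every vector of $\mathbb{F}_2^r$ (including zero) is the sum of at least $\ell$ and at most $R$ columns lying in pairwise distinct subsets. $\ell_2(r,R)$ is the smallest length of a binary linear code of codimension $r$ and covering radius $R$. *)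

(* Defs.v *)
From HB Require Import structures.
From mathcomp Require Import all_boot all_order all_algebra.
From mathcomp Require Import all_classical all_reals all_analysis.
Set Implicit Arguments. Unset Strict Implicit. Unset Printing Implicit Defensive.
Import Order.TTheory GRing.Theory Num.Theory.
Local Open Scope ring_scope.

Definition F2 := 'F_2.

Definition colsum (r n : nat) (H : 'M[F2]_(r, n)) (S : {set 'I_n}) : 'cV[F2]_r :=
  \sum_(j in S) col j H.

Definition wt (n : nat) (c : 'rV[F2]_n) : nat := #|[set j | c 0 j != 0]|.

Definition is_codeword (r n : nat) (H : 'M[F2]_(r, n)) (c : 'rV[F2]_n) : bool :=
  H *m c^T == 0.

Definition min_dist_eq (r n : nat) (H : 'M[F2]_(r, n)) (d : nat) : Prop :=
  (exists c : 'rV[F2]_n, [/\ is_codeword H c, c != 0 & wt c = d]) /\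
  (forall c : 'rV[F2]_n, is_codeword H c -> c != 0 -> (d <= wt c)%N).

Definition covers_within (r n : nat) (H : 'M[F2]_(r, n)) (R : nat) : Prop :=
  forall v : 'cV[F2]_r, exists S : {set 'I_n}, (#|S| <= R)%N /\ colsum H S = v.

Definition covering_radius_eq (r n : nat) (H : 'M[F2]_(r, n)) (R : nat) : Prop :=
  covers_within H R /\ (forall R', covers_within H R' -> (R <= R')%N).

Definition RL_partition (r n : nat) (H : 'M[F2]_(r, n)) (R l : nat)
    (P : {set {set 'I_n}}) : Prop :=
  finset.partition P [set: 'I_n] /\
  forall v : 'cV[F2]_r, exists S : {set 'I_n},
    [/\ (l <= #|S| <= R)%N,
        {in S &, forall i j, finset.pblock P i = finset.pblock P j -> i = j}
      & colsum H S = v].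

(* H is a parity-check matrix of an [n, n-r, d]_2 R,l code admitting an
   (R,l)-partition (codimension r <-> H has full row rank r) *)
Definition is_code_param (r n : nat) (H : 'M[F2]_(r, n)) (d R l : nat) : Prop :=
  [/\ \rank H = r, min_dist_eq H d, covering_radius_eq H R
    & exists P : {set {set 'I_n}}, RL_partition H R l P].

Definition has_code (r n R : nat) : Prop :=
  exists H : 'M[F2]_(r, n), \rank H = r /\ covering_radius_eq H R.

Definition is_l2 (r R m : nat) : Prop :=
  has_code r m R /\ (forall n', has_code r n' R -> (m <= n')%N).

Definition density3 (K : realType) (n r : nat) : K :=
  (\sum_(i < 4) 'C(n, i))%:R / (2 ^ r)%:R.

(* Main.v *)
(* The codes come from Davydov's q^m-concatenation. Given columns h_i of covering
   radius 3 and distinct labels b_i in F_{2^m}, take the columns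
   (h_i, x, b_i x, b_i^2 x) for x in F_{2^m}. A sum of three old columns with distinct
   labels lifts to every extension, because a 3x3 Vandermonde system is solvable; a sum
   of two fixes the coordinates x and b x, and one of the 2^m - 1 additional columns
   (0, 0, 0, z) repairs the last one. Labelling by the classes of a (3,2)-partition
   keeps the partition property, so r grows by 3m and n + 1 is multiplied by 2^m as
   soon as there are at most 2^m classes.

   The code of codimension 26 applies the same idea to the 23 columns of the Golay
   code with m = 5: 23 * 32 columns, 31 columns (0, 0, 0, z), and 51 columns
   (0, c, 0) where the vectors c in F_32^2 are the parity-check columns of a
   [51, 41] code of covering radius 2. It has 818 columns in 47 classes, whence the
   requirement m >= 6 for the next step. *)
Require Import Defs.
From HB Require Import structures.
From mathcomp Require Import all_boot all_order all_algebra all_fingroup all_field.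
From mathcomp Require Import all_classical all_reals all_analysis.
From mathcomp Require Import ring zify.
Set Implicit Arguments. Unset Strict Implicit. Unset Printing Implicit Defensive.
Import Order.TTheory GRing.Theory Num.Theory.
Local Open Scope ring_scope.

(** * Coverings and concatenation *)

Definition covers23 (V : zmodType) (I : Type) (K : eqType) (h : I -> V) (c : I -> K) :=
  forall v, (exists i j, c i != c j /\ h i + h j = v) \/
    (exists i j k, [/\ c i != c j, c i != c k, c j != c k & h i + h j + h k = v]).

(** Injectivity and nonvanishing will force minimum distance at least 3, and the values of [c] name
    the blocks of the partition. Columns may lie in any additive group and carry any index type, so
    that concatenation needs no matrices. *)
Definition proper_covering (V : zmodType) (I : Type) (K : eqType) (h : I -> V) (c : I -> K) :=
  [/\ injective h, forall i, h i != 0 & covers23 h c].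

Lemma vandermonde2 (F : fieldType) (a b p q : F) : a != b ->
  exists x y, x + y = p /\ a * x + b * y = q.
Proof.
rewrite -subr_eq0 => ab.
exists ((q - b * p) / (a - b)), ((a * p - q) / (a - b)).
by split; field.
Qed.

Lemma vandermonde3 (F : fieldType) (a b c p q r : F) :
  a != b -> a != c -> b != c ->
  exists x y z, [/\ x + y + z = p, a * x + b * y + c * z = q
    & a ^+ 2 * x + b ^+ 2 * y + c ^+ 2 * z = r].
Proof.
rewrite -[a == b]subr_eq0 -[a == c]subr_eq0 -[b == c]subr_eq0 => ab ac bc.
exists ((r - (b + c) * q + b * c * p) / ((a - b) * (a - c))),
  (- (r - (a + c) * q + a * c * p) / ((a - b) * (b - c))),
  ((r - (a + b) * q + a * b * p) / ((a - c) * (b - c))).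
by split; field; rewrite ?ab ?ac ?bc.
Qed.

Section Concatenation.
Variables (F : finFieldType) (V : zmodType) (I : finType).

Definition qm_index := (I * F + {z : F | z != 0})%type.

Definition qm_col (h : I -> V) (b : I -> F) (i : qm_index) : V * (F * (F * F)) :=
  match i with
  | inl (i, x) => (h i, (x, (b i * x, b i ^+ 2 * x)))
  | inr z => (0, (0, (0, val z)))
  end.

(** A single class [None] suffices for the additional columns, since no representation uses more
    than one of them. *)
Definition qm_class (b : I -> F) (i : qm_index) : option F :=
  if i is inl (i, _) then Some (b i) else None.

Lemma card_qm_index : #|{: qm_index}| = (#|I| * #|F| + #|F|.-1)%N.
Proof. by rewrite card_sum card_prod card_sig -(cardC1 (0 : F)). Qed.

Lemma qm_covering h b : proper_covering h b ->
  proper_covering (qm_col h b) (qm_class b).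
Proof.
move=> [injh h0 cov]; split.
- move=> [[i x]|z] [[j y]|z'] //=.
  + by case=> /injh -> ->.
  + by case=> /eqP; rewrite (negPf (h0 i)).
  + by case=> /esym/eqP; rewrite (negPf (h0 j)).
  + by case=> /val_inj ->.
- move=> [[i x]|[z z0]] /=; first by apply: contraNneq (h0 i) => -[->].
  by apply: contraNneq z0 => -[->].
- move=> [s [p [q r]]].
  have [[i [j [bij hij]]]|[i [j [k [bij bik bjk hijk]]]]] := cov s; last first.
    have [x [y [z [e1 e2 e3]]]] := vandermonde3 p q r bij bik bjk.
    right; exists (inl (i, x)), (inl (j, y)), (inl (k, z)); split=> //.
    by rewrite /= -hijk -e1 -e2 -e3.
  have [x [y [e1 e2]]] := vandermonde2 p q bij.
  (* Additional columns have nonzero last coordinate, so a pair with no defect there must stand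
     alone; otherwise the defect itself is the third column. *)
  have [e3|r0] := eqVneq r (b i ^+ 2 * x + b j ^+ 2 * y).
    left; exists (inl (i, x)), (inl (j, y)); split=> //.
    by rewrite /= -hij -e1 -e2 e3.
  right; rewrite -subr_eq0 in r0.
  exists (inl (i, x)), (inl (j, y)), (inr (exist (fun z => z != 0) _ r0)); split=> //=.
  rewrite -hij -e1 -e2; congr (_, (_, (_, _))); rewrite /= ?addr0 //.
  by rewrite addrC subrK.
Qed.

End Concatenation.

(** * Transport, reindexing and relabelling of coverings *)

(** Coverings involve only sums of columns, so additivity is all the structure that must be carried
    over to column vectors. *)
Definition additive_bijection (V W : zmodType) :=
  exists f : V -> W, {morph f : x y / x + y} /\ bijective f.

Lemma additive_bijection_prod (R : nzRingType) (V W : zmodType) m n :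
  additive_bijection V 'cV[R]_m -> additive_bijection W 'cV[R]_n ->
  additive_bijection (V * W)%type 'cV[R]_(m + n).
Proof.
move=> [f [fD [f' fK f'K]]] [g [gD [g' gK g'K]]].
exists (fun v => col_mx (f v.1) (g v.2)); split.
  by move=> x y; rewrite fD gD add_col_mx.
exists (fun u => (f' (usubmx u), g' (dsubmx u))) => [[x y]|u] /=.
  by rewrite col_mxKu col_mxKd fK gK.
by rewrite f'K g'K vsubmxK.
Qed.

Lemma additive_bijection_finField (F : finFieldType) m : #|F| = (2 ^ m)%N ->
  additive_bijection F 'cV['F_2]_m.
Proof.
move=> cardF.
have ch := card_finPcharP cardF (isT : prime 2).
have := pprimeChar_vectAxiom ch; rewrite [#|_|]cardF pfactorK // => -[f linf [g fK gK]].
exists (fun x : F => (f x)^T); split.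
  by move=> x y; have := linf 1 x y; rewrite !scale1r => ->; rewrite linearD.
exists (fun u => g u^T) => x; first by rewrite trmxK fK.
by rewrite gK trmxK.
Qed.

Lemma proper_covering_comp (V W : zmodType) (I : Type) (K : eqType)
    (h : I -> V) (c : I -> K) (f : V -> W) :
  {morph f : x y / x + y} -> bijective f ->
  proper_covering h c -> proper_covering (f \o h) c.
Proof.
move=> fD [f' fK f'K] [injh h0 cov].
have f0 : f 0 = 0 by apply: (addrI (f 0)); rewrite -fD !addr0.
split.
- by move=> i j /= /(can_inj fK)/injh.
- by move=> i; rewrite /= -f0 (can_eq fK).
move=> v; have [[i [j [cij e]]]|[i [j [k [cij cik cjk e]]]]] := cov (f' v).
  by left; exists i, j; rewrite /= -fD e f'K.
by right; exists i, j, k; split; rewrite //= -!fD e f'K.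
Qed.

Lemma proper_covering_reindex (V : zmodType) (I J : Type) (K : eqType)
    (h : I -> V) (c : I -> K) (g : J -> I) : bijective g ->
  proper_covering h c -> proper_covering (h \o g) (c \o g).
Proof.
move=> [g' gK g'K] [injh h0 cov]; split.
- exact: inj_comp injh (can_inj gK).
- by move=> j; apply: h0.
move=> v; have [[i [j [cij e]]]|[i [j [k [cij cik cjk e]]]]] := cov v.
  by left; exists (g' i), (g' j); rewrite /= !g'K.
by right; exists (g' i), (g' j), (g' k); split; rewrite /= ?g'K.
Qed.

(** Serves to replace numeric classes by distinct field elements, the labels required by
    concatenation. *)
Lemma proper_covering_refine (V : zmodType) (I : Type) (K L : eqType)
    (h : I -> V) (c : I -> K) (d : I -> L) :
  (forall i j, d i = d j -> c i = c j) ->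
  proper_covering h c -> proper_covering h d.
Proof.
move=> dc [injh h0 cov].
have cd i j : c i != c j -> d i != d j by apply: contra_neq; apply: dc.
split=> // v; have [[i [j [/cd cij e]]]|] := cov v; first by left; exists i, j.
by move=> [i [j [k [/cd cij /cd cik /cd cjk e]]]]; right; exists i, j, k.
Qed.

(** * From coverings to codes *)

Lemma F2_neq0 (x : F2) : x != 0 -> x = 1.
Proof. by case: x => [[|[|k]]] // lk _; apply: val_inj. Qed.

Lemma addmx_F2 m n (A : 'M[F2]_(m, n)) : A + A = 0.
Proof.
apply/matrixP => i j; rewrite !mxE.
by have [->|/F2_neq0 ->] := eqVneq (A i j) 0; [rewrite addr0|apply: val_inj].
Qed.

Lemma oppmx_F2 m n (A : 'M[F2]_(m, n)) : - A = A.
Proof. by apply/eqP; rewrite -subr_eq0 -opprD addmx_F2 oppr0. Qed.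

Lemma mulmx_colsum r n (H : 'M[F2]_(r, n)) (c : 'rV[F2]_n) :
  H *m c^T = colsum H [set j | c 0 j != 0]%SET.
Proof.
rewrite /colsum; apply/colP => i; rewrite mxE summxE.
rewrite [RHS]big_mkcond /=; apply: eq_bigr => j _.
rewrite !mxE inE; case: eqVneq => [->|/F2_neq0 ->]; first by rewrite mulr0.
by rewrite mulr1.
Qed.

(** The sets of columns summing to the unit vectors are the columns of a right inverse of [H]. *)
Lemma covers_within_rank r n (H : 'M[F2]_(r, n)) R :
  covers_within H R -> \rank H = r.
Proof.
move=> cov; apply/eqP; apply/row_freeP.
have /choice[S SP] : forall i : 'I_r, exists S, colsum H S = delta_mx i 0.
  by move=> i; have [S [_ e]] := cov (delta_mx i 0); exists S.
exists (\matrix_(j, i) (j \in S i)%:R); apply/matrixP => k i.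
have /matrixP/(_ k 0) := SP i; rewrite /colsum summxE !mxE eqxx andbT => <-.
rewrite [RHS]big_mkcond /=; apply: eq_bigr => j _; rewrite !mxE.
by case: ifP => _; rewrite ?mulr1 ?mulr0.
Qed.

(** Each sum of at most two columns comes from a pair of optional indices, [None] standing for a
    missing summand; there are (n+1)^2 such pairs. *)
Lemma covers_within2_card r n (H : 'M[F2]_(r, n)) :
  covers_within H 2 -> (2 ^ r <= n.+1 ^ 2)%N.
Proof.
move=> cov.
pose f (p : option 'I_n * option 'I_n) : 'cV[F2]_r :=
  oapp (fun j => col j H) 0 p.1 + oapp (fun j => col j H) 0 p.2.
have fsurj v : v \in codom f.
  have [S [cS <-]] := cov v; apply/codomP.
  have [|c1] := leqP #|S| 0.
    rewrite leqn0 cards_eq0 => /eqP ->; exists (None, None).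
    by rewrite /colsum big_set0 /f /= addr0.
  have [|c2] := leqP #|S| 1.
    move=> c1'; have /cards1P[i ->] : #|S| == 1%N by rewrite eqn_leq c1' c1.
    by exists (Some i, None); rewrite /colsum big_set1 /f /= addr0.
  have /cards2P[i [j [ij ->]]] : #|S| == 2 by rewrite eqn_leq cS c2.
  by exists (Some i, Some j); rewrite /colsum big_setU1 ?inE // big_set1.
have := leq_image_card f predT.
have -> : #|codom f| = #|{: 'cV[F2]_r}| by apply: eq_card => v; rewrite fsurj.
by rewrite card_mx card_Fp // muln1 card_prod card_option card_ord mulnn.
Qed.

Section Code.
Variables (r n : nat) (K : eqType) (h : 'I_n -> 'cV[F2]_r) (c : 'I_n -> K).
Hypothesis cov : proper_covering h c.

Let H : 'M[F2]_(r, n) := \matrix_(i, j) h j i 0.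

Let colH j : col j H = h j.
Proof. by apply/colP => i; rewrite !mxE. Qed.

Let P := preim_partition c [set: 'I_n]%SET.

Let pblockP i j : finset.pblock P i = finset.pblock P j -> c i = c j.
Proof.
have /and3P[/eqP coverP trivP _] : finset.partition P [set: 'I_n]%SET by apply: preim_partitionP.
have inP (k : 'I_n) : k \in finset.cover P by rewrite coverP finset.in_setT.
move=> /eqP; rewrite eq_pblock // => jPi; apply/eqP; move: jPi.
by rewrite pblock_equivalence_partition ?finset.in_setT // => x y z _ _ _; split=> // /eqP ->.
Qed.

Let colsum2 i j : i != j -> colsum H [set i; j]%SET = h i + h j.
Proof. by move=> ij; rewrite /colsum big_setU1 ?inE // big_set1 !colH. Qed.

Let colsum3 i j k : i != j -> i != k -> j != k ->
  colsum H [set i; j; k]%SET = h i + h j + h k.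
Proof.
move=> ij ik jk; rewrite /colsum -finset.setUA big_setU1 ?inE ?negb_or ?ij //=.
by rewrite -addrA -!colH -/(colsum H [set j; k]%SET) colsum2 // -!colH.
Qed.

Lemma RL_partition_covering : RL_partition H 3 2 P.
Proof.
have [_ _ cv] := cov; split; first exact: preim_partitionP.
have ne i j : c i != c j -> i != j by apply: contra_neq => ->.
move=> v; have [[i [j [cij <-]]]|[i [j [k [cij cik cjk <-]]]]] := cv v.
  exists [set i; j]%SET; split; last by rewrite colsum2 ?ne.
    by rewrite cards2 ne.
  by move=> x y; rewrite !inE => /orP[]/eqP-> /orP[]/eqP-> // /pblockP/eqP;
     rewrite ?(negPf cij) // eq_sym (negPf cij).
exists [set i; j; k]%SET; split; last by rewrite colsum3 ?ne.
  by rewrite -finset.setUA cardsU1 cards2 !inE negb_or !ne.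
move=> x y; rewrite !inE -!orbA => /or3P[]/eqP-> /or3P[]/eqP-> // /pblockP/eqP;
  by rewrite ?(negPf cij) ?(negPf cik) ?(negPf cjk) // eq_sym
     ?(negPf cij) ?(negPf cik) ?(negPf cjk).
Qed.

(** In characteristic 2 two distinct columns never sum to zero, so the representation of 0 is a
    triple, the support of a codeword of weight 3. A smaller weight would need a zero column or two
    equal ones. *)
Lemma min_dist_covering : min_dist_eq H 3.
Proof.
have [injh h0 cv] := cov.
have ne i j : c i != c j -> i != j by apply: contra_neq => ->.
split.
  have [[i [j [cij e]]]|[i [j [k [cij cik cjk e]]]]] := cv 0.
    have : i != j by apply: ne.
    by rewrite -(inj_eq injh) -subr_eq0 oppmx_F2 e eqxx.
  pose S := [set i; j; k]%SET.
  exists (\row_l (l \in S)%:R).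
  have eS : [set l | (\row_l (l \in S)%:R : 'rV[F2]_n) 0 l != 0]%SET = S.
    by apply/setP => l; rewrite inE mxE; case: (l \in S); rewrite ?oner_eq0 ?eqxx.
  split.
  - by rewrite /is_codeword mulmx_colsum eS colsum3 ?ne // e.
  - apply/eqP => /matrixP/(_ 0 i)/eqP; rewrite !mxE !inE eqxx /=.
    by rewrite oner_eq0.
  - by rewrite /wt eS /S -finset.setUA cardsU1 cards2 !inE negb_or !ne.
move=> w; rewrite /is_codeword mulmx_colsum => /eqP Hw w0.
rewrite leqNgt; apply/negP; rewrite /wt; set S := [set _ | _]%SET in Hw * => cS.
have [c0|c1] := leqP #|S| 0.
  move: w0; case/negP; apply/eqP/rowP => l; rewrite mxE; apply/eqP.
  have : l \notin S by move: c0; rewrite leqn0 cards_eq0 => /eqP ->; rewrite inE.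
  by rewrite inE negbK.
have [c1'|c2] := leqP #|S| 1.
  have /cards1P[i eS] : #|S| == 1%N by rewrite eqn_leq c1' c1.
  by move: Hw; rewrite eS /colsum big_set1 colH => /eqP; rewrite (negPf (h0 i)).
have /cards2P[i [j [ij eS]]] : #|S| == 2 by rewrite eqn_leq c2 -ltnS cS.
move: Hw; rewrite eS colsum2 // => /eqP.
by rewrite -{1}[h j]oppmx_F2 subr_eq0 (inj_eq injh) (negPf ij).
Qed.

(** The counting hypothesis excludes covering radius 2 or less; everything else comes from the
    covering. *)
Lemma code_covering : (n.+1 ^ 2 < 2 ^ r)%N -> exists H : 'M[F2]_(r, n), is_code_param H 3 3 2.
Proof.
move=> small.
have cov3 : covers_within H 3.
  move=> v; have [_ /(_ v)[S [/andP[_ cS] _ e]]] := RL_partition_covering.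
  by exists S.
exists H; split.
- exact: covers_within_rank cov3.
- exact: min_dist_covering.
- split=> // R' covR; rewrite leqNgt; apply/negP => R3.
  suff /covers_within2_card : covers_within H 2 by rewrite leqNgt small.
  by move=> v; have [S [cS e]] := covR v; exists S; split; rewrite // (leq_trans cS).
- by exists P; apply: RL_partition_covering.
Qed.
End Code.

(** * Finite checks on bit sequences *)

Definition bitxor (s t : bitseq) : bitseq := [seq p.1 (+) p.2 | p <- zip s t].

Fixpoint bits (k n : nat) : bitseq :=
  if k is k'.+1 then odd n :: bits k' n./2 else [::].

(* Radix partitioning keeps the exhaustive checks below cheap: every list is
   traversed once per bit. *)
Fixpoint covers_cube (k : nat) (L : seq bitseq) : bool :=
  if k is k'.+1 then
    covers_cube k' [seq behead s | s <- L & ~~ head false s] &&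
    covers_cube k' [seq behead s | s <- L & head false s]
  else ~~ nilp L.

Lemma covers_cubeP k L s : all (fun t => size t == k) L -> covers_cube k L ->
  size s = k -> s \in L.
Proof.
elim: k L s => [|k IH] L s /=.
  case: L => [|t L] //= /andP[/nilP tL _] _ /size0nil ->.
  by rewrite tL mem_head.
move=> /allP sL /andP[c0 c1]; case: s => // b s [sk].
have aux a : all (fun t => size t == k) [seq behead s | s <- [seq t <- L | a t]].
  apply/allP => t' /mapP[t]; rewrite mem_filter => /andP[_ /sL/eqP tk] ->.
  by rewrite size_behead tk.
have main (a : pred bitseq) : (forall t, a t = (head false t == b)) ->
    covers_cube k [seq behead s | s <- [seq t <- L | a t]] -> b :: s \in L.
  move=> ab /(IH _ s (aux a))/(_ sk)/mapP[[|b' t]].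
    by rewrite mem_filter => /andP[_ /sL].
  by rewrite mem_filter ab /= => /andP[/eqP -> tL] ->.
case: b main => main; [apply: main c1 | apply: main c0] => t;
  by case: (head _ _).
Qed.

(** * Evaluation of bit sequences in a group of exponent 2 *)

Section Evaluation.
Variable V : zmodType.
Hypothesis V2 : forall v : V, v + v = 0.

(** The field of 32 elements is given only abstractly: checks are computed on bit sequences and
    transferred by this map, [B] being a basis in the applications. *)
Fixpoint bitcomb (B : seq V) (s : bitseq) : V :=
  match B, s with
  | b :: B', x :: s' => (if x then b else 0) + bitcomb B' s'
  | _, _ => 0
  end.

Lemma bitcomb_xor B s t : size s = size t ->
  bitcomb B (bitxor s t) = bitcomb B s + bitcomb B t.
Proof.
elim: B s t => [|b B IH] [|x s] [|y t] //=; rewrite ?addr0 // => -[/IH ->].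
rewrite addrACA; congr (_ + _).
by case: x; case: y; rewrite /= ?V2 ?addr0 ?add0r.
Qed.

Lemma bitcomb_map (I : Type) (f : I -> V) (g : I -> bool) (l : seq I) :
  bitcomb (map f l) (map g l) = \sum_(i <- l) if g i then f i else 0.
Proof. by elim: l => [|i l IH] /=; rewrite ?big_nil ?big_cons ?IH. Qed.

Lemma bitcomb_nseq0 B k : bitcomb B (nseq k false) = 0.
Proof. by elim: k B => [|k IH] [|b B] //=; rewrite IH addr0. Qed.

End Evaluation.

Lemma size_bitxor s t : size (bitxor s t) = minn (size s) (size t).
Proof. by rewrite size_map size_zip. Qed.

Lemma bitxor_eq0 s t : size s = size t -> bitxor s t = nseq (size s) false -> s = t.
Proof.
elim: s t => [|x s IH] [|y t] //= [st] [xy /(IH _ st) ->].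
by congr (_ :: _); case: x y xy => -[].
Qed.

(* Multiplication by X modulo X^k + g, constant coefficient first. *)
Definition lfsr (g s : bitseq) : bitseq :=
  bitxor (false :: take (size s).-1 s)
         (if last false s then g else nseq (size s) false).

(* 739 encodes X^9 + X^7 + X^6 + X^5 + X + 1, so that column i is X^i modulo the
   generator polynomial of the perfect [23, 12, 7] code. *)
Definition golay_table : seq bitseq := traject (lfsr (bits 11 739)) (bits 11 1) 23.

Definition golay (i : nat) : bitseq := nth [::] golay_table i.

Definition golay_sums : seq bitseq :=
  nseq 11 false :: [seq golay i | i <- iota 0 23]
  ++ [seq bitxor (golay i) (golay j) | i <- iota 0 23, j <- iota 0 i]
  ++ [seq bitxor (bitxor (golay p.1) (golay p.2)) (golay k) |
        p <- [seq (i, j) | i <- iota 0 23, j <- iota 0 i], k <- iota 0 p.2].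

(** Perfection of the Golay code: 1 + 23 + 253 + 1771 = 2^11. *)
Lemma golay_sums_full : covers_cube 11 golay_sums.
Proof. by vm_compute. Qed.

(* Parity-check columns of a [51, 41] code of covering radius 2. Splitting ten bits
   as 3 + 3 + 4 (lowest first), line m < 5 lists the columns (x, s_m x, h_m), x in F_8,
   for the columns h_m of the [5, 1] repetition code and five distinct slopes s_m,
   (0, x) standing for the infinite one;
   the last line, found by computer search, has the form (e, 0) with e in F_8^2. *)
Definition sat_table : seq bitseq :=
  [seq bits 10 i | i <-
    [:: 64; 105; 74; 99; 84; 125; 94; 119;
        128; 136; 144; 152; 160; 168; 176; 184;
        256; 289; 282; 315; 308; 277; 302; 271;
        512; 569; 554; 531; 524; 565; 550; 543;
        960; 1009; 1018; 971; 1004; 989; 982; 999;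
        10; 19; 36; 49; 51; 53; 54; 56; 60; 62; 63]].

Definition sat (i : nat) : bitseq := nth [::] sat_table i.

(* In each block of eight the column x = 0 is set apart, so that any nonzero
   difference in the block is a sum across two classes. *)
Definition sat_class (i : nat) : nat :=
  if (i < 40)%N then ((i %/ 8).*2 + (i %% 8 != 0))%N else (i - 30)%N.

Definition sat_pairs : seq (nat * nat) :=
  [seq p <- [seq (i, j) | i <- iota 0 51, j <- iota 0 i] |
     sat_class p.1 != sat_class p.2].

(* Third summands 41 and 42 suffice for the twelve vectors missed by the pairs. *)
Definition sat_triples : seq (nat * nat * nat) :=
  [seq t <- [seq (p, k) | p <- sat_pairs, k <- [:: 41; 42]] |
     (sat_class t.1.1 != sat_class t.2) && (sat_class t.1.2 != sat_class t.2)].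

Definition sat_sum2 (p : nat * nat) := bitxor (sat p.1) (sat p.2).

(** For targets where a column of another kind takes part, so that a single column of this kind is
    allowed. *)
Lemma sat_sums12_full : covers_cube 10
  (nseq 10 false :: [seq sat i | i <- iota 0 51] ++ [seq sat_sum2 p | p <- sat_pairs]).
Proof. by vm_compute. Qed.

(** For targets where these columns are used alone, hence at least two of them. *)
Lemma sat_sums23_full : covers_cube 10
  ([seq sat_sum2 p | p <- sat_pairs] ++
   [seq bitxor (sat_sum2 t.1) (sat t.2) | t <- sat_triples]).
Proof. by vm_compute. Qed.

Lemma golay_sums_sizes : all (fun s => size s == 11) golay_sums.
Proof. by vm_compute. Qed.

Lemma sat_sums12_sizes : all (fun s => size s == 10)
  (nseq 10 false :: [seq sat i | i <- iota 0 51] ++ [seq sat_sum2 p | p <- sat_pairs]).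
Proof. by vm_compute. Qed.

Lemma sat_sums23_sizes : all (fun s => size s == 10)
  ([seq sat_sum2 p | p <- sat_pairs] ++
   [seq bitxor (sat_sum2 t.1) (sat t.2) | t <- sat_triples]).
Proof. by vm_compute. Qed.

Lemma golay_table_uniq :
  [&& size golay_table == 23, uniq golay_table & nseq 11 false \notin golay_table].
Proof. by vm_compute. Qed.

Lemma sat_table_uniq :
  [&& size sat_table == 51, uniq sat_table & nseq 10 false \notin sat_table].
Proof. by vm_compute. Qed.

(** [bits 5 5] encodes X^2 + 1, so the modulus is X^5 + X^2 + 1, which [mulw_orbit] shows to be
    primitive. *)
Definition mulw : bitseq -> bitseq := lfsr (bits 5 5).

Lemma mulw_orbit :
  covers_cube 5 (nseq 5 false :: [seq iter k mulw (bits 5 1) | k <- iota 0 31]).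
Proof. by vm_compute. Qed.

(** A target that is itself a Golay-type column with label w^j has to be rewritten as a sum of
    several columns; this takes a column of [sat] in the direction (1, w^j). *)
Lemma sat_slopes : all (fun j => has (fun k => (take 5 (sat k) != nseq 5 false) &&
  (drop 5 (sat k) == iter j mulw (take 5 (sat k)))) (iota 0 51)) (iota 0 23).
Proof. by vm_compute. Qed.

Lemma golay_table_sizes : all (fun s => size s == 11) golay_table.
Proof. by vm_compute. Qed.

Lemma sat_table_sizes : all (fun s => size s == 10) sat_table.
Proof. by vm_compute. Qed.

(* Otherwise closing tactics evaluate the tables. *)
#[global] Opaque golay_table sat_table.

Lemma size_golay i : (i < 23)%N -> size (golay i) = 11.
Proof.
have := golay_table_sizes.
by have /andP[/eqP gs _] := golay_table_uniq => /all_nthP h i23; apply/eqP/h; rewrite gs.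
Qed.

Lemma size_sat i : (i < 51)%N -> size (sat i) = 10.
Proof.
have := sat_table_sizes.
by have /andP[/eqP ss _] := sat_table_uniq => /all_nthP h i51; apply/eqP/h; rewrite ss.
Qed.

Lemma uniq_nth_inj (T : eqType) (x0 : T) (s : seq T) n :
  size s = n -> uniq s -> injective (fun i : 'I_n => nth x0 s i).
Proof. by move=> <- us i j /eqP; rewrite nth_uniq // => /eqP/val_inj. Qed.

Lemma golay_inj : injective (fun i : 'I_23 => golay i).
Proof. by have /and3P[/eqP sz U _] := golay_table_uniq; apply: uniq_nth_inj sz U. Qed.

Lemma sat_inj : injective (fun i : 'I_51 => sat i).
Proof. by have /and3P[/eqP sz U _] := sat_table_uniq; apply: uniq_nth_inj sz U. Qed.

Lemma golay_neq0 (i : 'I_23) : golay i <> nseq 11 false.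
Proof.
have /and3P[/eqP gs _ /negP g0] := golay_table_uniq => e; apply: g0.
by rewrite -e mem_nth ?gs.
Qed.

Lemma sat_neq0 (i : 'I_51) : sat i <> nseq 10 false.
Proof.
have /and3P[/eqP ss _ /negP s0] := sat_table_uniq => e; apply: s0.
by rewrite -e mem_nth ?ss.
Qed.

#[global] Opaque golay sat.

(** * The code of codimension 26 *)

Lemma pchar2_addrr (F : finFieldType) m : #|F| = (2 ^ m)%N -> forall x : F, x + x = 0.
Proof. by move=> cF x; apply/addrr_pchar2/(card_finPcharP cF). Qed.

(** Every nonzero x satisfies x^31 + 1 = 0. If the quintic had no root, all 31 nonzero elements
    would be roots of the cofactor [q], of degree at most 26. *)
Lemma exists_root_quintic (F : finFieldType) : #|F| = 32 ->
  exists w : F, w ^+ 5 = w ^+ 2 + 1.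
Proof.
move=> cF; have addFF := @pchar2_addrr F 5 cF.
(* q is (X^31 + 1) / (X^5 + X^2 + 1) modulo 2. *)
pose q : {poly F} := Poly [:: 1; 0; 1; 0; 1; 1; 1; 0; 1; 1; 0; 0; 0; 1; 1; 1; 1; 1;
  0; 0; 1; 1; 0; 1; 0; 0; 1].
have qE (x : F) : (x ^+ 5 + x ^+ 2 + 1) * q.[x] = x ^+ 31 + 1.
  rewrite /q horner_Poly /=.
  have two0 : 2 = 0 :> F by rewrite -[2]/(1 + 1)%R addFF.
  ring: two0.
have [/existsP[w /eqP wE]|/existsPn noroot] := boolP [exists w : F, w ^+ 5 == w ^+ 2 + 1].
  by exists w.
have q0 : q != 0.
  apply/eqP => q0; have := qE 0; rewrite q0 horner0 mulr0 expr0n add0r => /esym/eqP.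
  by rewrite oner_eq0.
have sq : (size q <= 27)%N by apply: size_Poly.
suff /(max_poly_roots q0) : all (root q) (enum [pred x : F | x != 0]).
  by move/(_ (enum_uniq _))/leq_trans/(_ sq); rewrite -cardE cardC1 cF.
apply/allP => x; rewrite mem_enum inE => x0.
have x31 : x ^+ 31 = 1 by apply: (mulfI x0); rewrite -exprS mulr1 -[RHS]expf_card cF.
have /eqP := qE x; rewrite x31 addFF mulf_eq0 => /orP[|//] /eqP r0.
case/negP: (noroot x); apply/eqP.
by apply: (addIr (x ^+ 2 + 1)); rewrite addrA r0 addFF.
Qed.

Definition golay_vec : bitseq -> 'cV['F_2]_11 :=
  bitcomb [seq delta_mx i 0 | i <- enum 'I_11].

Lemma golay_vec_xor s t : size s = size t ->
  golay_vec (bitxor s t) = golay_vec s + golay_vec t.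
Proof. by apply: bitcomb_xor; apply: addmx_F2. Qed.

Lemma golay_vec_bits (v : 'cV['F_2]_11) :
  golay_vec [seq v i 0 != 0 | i <- enum 'I_11] = v.
Proof.
rewrite /golay_vec bitcomb_map [RHS]matrix_sum_delta big_enum /=.
apply: eq_bigr => i _; rewrite big_ord1.
have [->|/F2_neq0 ->] := eqVneq (v i 0) 0; first by rewrite scale0r.
by rewrite scale1r.
Qed.

Lemma golay_vec_eq0 s : size s = 11 -> golay_vec s = 0 -> s = nseq 11 false.
Proof.
move=> s11 /matrixP e; apply: (@eq_from_nth _ false) => [|k]; rewrite ?size_nseq // s11 => k11.
have sE : s = [seq nth false s (val i) | i <- enum 'I_11].
  by rewrite -[LHS](mkseq_nth false) s11 /mkseq -val_enum_ord -map_comp.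
rewrite nth_nseq k11; apply: contra_eqF (e (Ordinal k11) 0) => sk.
rewrite sE /golay_vec bitcomb_map big_enum summxE (bigD1 (Ordinal k11)) //=.
rewrite sk big1 => [|i ik]; first by rewrite !mxE !eqxx addr0 oner_eq0.
by case: ifP; rewrite !mxE // eq_sym (negPf ik).
Qed.

Lemma golay_cases (s : 'cV['F_2]_11) :
  [\/ s = 0, exists i : 'I_23, s = golay_vec (golay i),
   exists i j : 'I_23, i != j /\ s = golay_vec (golay i) + golay_vec (golay j) |
   exists i j k : 'I_23, [/\ i != j, i != k, j != k &
     s = golay_vec (golay i) + golay_vec (golay j) + golay_vec (golay k)]].
Proof.
have s11 : size [seq s i 0 != 0 | i <- enum 'I_11] = 11 by rewrite size_map size_enum_ord.
have := covers_cubeP golay_sums_sizes golay_sums_full s11.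
rewrite -[s in X in _ -> X]golay_vec_bits; move: [seq _ | _ <- _] => u.
have gE (i : 'I_23) : size (golay i) = 11 by apply: size_golay.
rewrite inE => /predU1P[->|]; first by constructor 1; apply: bitcomb_nseq0.
rewrite mem_cat => /orP[/mapP[i]|].
  by rewrite mem_iota => /= i23 ->; constructor 2; exists (Ordinal i23).
rewrite mem_cat => /orP[/allpairsPdep[i [j []]]|/allpairsPdep[[i' j'] [k []]]].
  rewrite !mem_iota /= => i23 ji ->; have j23 := ltn_trans ji i23.
  constructor 3; exists (Ordinal i23), (Ordinal j23).
  by rewrite golay_vec_xor ?(gE (Ordinal i23)) ?(gE (Ordinal j23)) // neq_ltn ji orbT.
case/allpairsPdep=> i [j []]; rewrite !mem_iota /= => i23 ji [-> ->] /= kj ->.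
have ki := ltn_trans kj ji; have [j23 k23] := (ltn_trans ji i23, ltn_trans ki i23).
constructor 4; exists (Ordinal i23), (Ordinal j23), (Ordinal k23).
rewrite !golay_vec_xor ?size_bitxor ?(gE (Ordinal i23)) ?(gE (Ordinal j23)) ?(gE (Ordinal k23)) //.
by split; rewrite // neq_ltn /= ?ji ?ki ?kj orbT.
Qed.

Lemma golay_vec_inj (i j : 'I_23) : golay_vec (golay i) = golay_vec (golay j) -> i = j.
Proof.
move=> e; have [si sj] := (size_golay (ltn_ord i), size_golay (ltn_ord j)).
have sij : size (golay i) = size (golay j) by rewrite si sj.
apply/golay_inj/bitxor_eq0 => //; rewrite si.
apply: golay_vec_eq0; first by rewrite size_bitxor si sj.
by rewrite golay_vec_xor // e addmx_F2.
Qed.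

Lemma golay_vec_neq0 (i : 'I_23) : golay_vec (golay i) != 0.
Proof. by apply/eqP => /(golay_vec_eq0 (size_golay (ltn_ord i))); apply: golay_neq0. Qed.

(** * Arithmetic of the field of 32 elements *)

Section BaseCode.
Variable F : finFieldType.
Hypothesis cardF : #|F| = 32.
Variable w : F.
Hypothesis w5 : w ^+ 5 = w ^+ 2 + 1.

Let addFF : forall x : F, x + x = 0 := @pchar2_addrr F 5 cardF.

Let w_neq0 : w != 0.
Proof. by apply: contra_eqN w5 => /eqP ->; rewrite !expr0n add0r eq_sym oner_eq0. Qed.

Let w_neq1 : w != 1.
Proof.
apply: contra_eqN w5 => /eqP ->; rewrite !expr1n addFF.
exact: oner_neq0.
Qed.

Let expf31 (x : F) : x != 0 -> x ^+ 31 = 1.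
Proof. by move=> x0; apply: (mulfI x0); rewrite -exprS mulr1 -[RHS]expf_card cardF. Qed.

(** The order of [w] divides the prime 31 and is not 1. *)
Lemma quintic_prim_root : 31.-primitive_root w.
Proof.
have /primeP[_ dv31] : prime 31 by [].
have [m wm] := @prim_order_exists _ 31 w isT (expf31 w_neq0).
move=> /dv31/orP[]/eqP mE; last by rewrite -mE.
by move: w_neq1; have := prim_expr_order wm; rewrite mE expr1 => -> /eqP.
Qed.

Definition ev5 : bitseq -> F := bitcomb [:: 1; w; w ^+ 2; w ^+ 3; w ^+ 4].

Lemma ev5_mulw s : size s = 5 -> ev5 (mulw s) = w * ev5 s.
Proof.
case: s => [|a [|b [|c [|d [|e [|]]]]]] // _.
rewrite /ev5 /mulw /lfsr [take _ _]/= [last _ _]/= [size _]/=.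
rewrite bitcomb_xor //; last by case: e.
(* The feedback word stands for the overflowing power w^5 = w^2 + 1. *)
have -> : bitcomb [:: 1; w; w ^+ 2; w ^+ 3; w ^+ 4]
    (if e then bits 5 5 else nseq 5 false) = if e then w ^+ 5 else 0.
  by case: e => /=; rewrite ?w5 !(addr0, add0r) // addrC.
rewrite /= !mulrDr.
by case: a; case: b; case: c; case: d; case: e; rewrite /= ?mulr0 ?mulr1; ring.
Qed.

Lemma size_mulw s : size s = 5 -> size (mulw s) = 5.
Proof. by case: s => [|a [|b [|c [|d [|e [|]]]]]] // _; case: e. Qed.

Lemma ev5_iter_mulw k s : size s = 5 ->
  size (iter k mulw s) = 5 /\ ev5 (iter k mulw s) = w ^+ k * ev5 s.
Proof.
move=> s5; elim: k => [|k [sk IH]] /=; first by rewrite mul1r.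
by rewrite size_mulw // ev5_mulw // IH mulrA exprS.
Qed.

Lemma ev5_one : ev5 (bits 5 1) = 1.
Proof. by rewrite /ev5 /= !addr0. Qed.

Lemma ev5_surj x : exists s, size s = 5 /\ ev5 s = x.
Proof.
have [->|x0] := eqVneq x 0; first by exists (nseq 5 false); rewrite /ev5 bitcomb_nseq0.
have [k ->] := prim_rootP quintic_prim_root (expf31 x0).
have [sk e] := @ev5_iter_mulw k (bits 5 1) erefl.
by exists (iter k mulw (bits 5 1)); rewrite e ev5_one mulr1.
Qed.

(** Independence of 1, w, ..., w^4: by [mulw_orbit] a nonzero sequence is a power of X, and its
    value w^k is nonzero. *)
Lemma ev5_eq0 s : size s = 5 -> ev5 s = 0 -> s = nseq 5 false.
Proof.
move=> /(covers_cubeP _ mulw_orbit) => /(_ isT).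
rewrite inE => /orP[/eqP //|/mapP[k _ ->]].
have [_ ->] := @ev5_iter_mulw k (bits 5 1) erefl.
by move/eqP; rewrite ev5_one mulr1 expf_eq0 (negPf w_neq0) andbF.
Qed.

Definition ev10 (s : bitseq) : F * F := (ev5 (take 5 s), ev5 (drop 5 s)).

Lemma take_bitxor n s t : take n (bitxor s t) = bitxor (take n s) (take n t).
Proof.
by elim: n s t => [|n IH] [|x s] [|y t] //=; rewrite IH.
Qed.

Lemma drop_bitxor n s t : drop n (bitxor s t) = bitxor (drop n s) (drop n t).
Proof.
elim: n s t => [|n IH] [|x s] [|y t] //=; last exact: IH.
  by case: (drop n t).
by case: (drop n s).
Qed.

Lemma ev10_xor s t : size s = size t -> ev10 (bitxor s t) = ev10 s + ev10 t.
Proof.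
move=> st; rewrite /ev10 take_bitxor drop_bitxor /ev5.
by rewrite !bitcomb_xor // ?size_take ?size_drop st.
Qed.

Lemma ev10_surj v : exists s, size s = 10 /\ ev10 s = v.
Proof.
case: v => x y.
have [s [s5 <-]] := ev5_surj x; have [t [t5 <-]] := ev5_surj y.
by exists (s ++ t); rewrite size_cat s5 t5 /ev10 take_size_cat // drop_size_cat.
Qed.

Lemma ev10_eq0 s : size s = 10 -> ev10 s = 0 -> s = nseq 10 false.
Proof.
move=> s10 e; rewrite -[s](cat_take_drop 5).
have t5 : size (take 5 s) = 5 by rewrite size_take s10.
have d5 : size (drop 5 s) = 5 by rewrite size_drop s10.
by rewrite (ev5_eq0 t5 (congr1 fst e)) (ev5_eq0 d5 (congr1 snd e)).
Qed.

(** * Columns and classes of the base code *)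

Definition base_index := ('I_23 * F + ({z : F | z != 0%R} + 'I_51))%type.

(** The labels are the powers w^j, j < 23, distinct because [w] has order 31. The first two field
    coordinates are grouped because the columns of [sat] cover them jointly. *)
Definition base_col (i : base_index) : 'cV['F_2]_11 * ((F * F) * F) :=
  match i with
  | inl (j, x) => (golay_vec (golay j), ((x, w ^+ j * x), (w ^+ j) ^+ 2 * x))
  | inr (inl z) => (0, (0, val z))
  | inr (inr k) => (0, (ev10 (sat k), 0))
  end.

Lemma ev10_sat_neq0 (i : 'I_51) : ev10 (sat i) != 0.
Proof. by apply/eqP => /(ev10_eq0 (size_sat (ltn_ord i))); apply: sat_neq0. Qed.

Let addFFF (v : F * F) : v + v = 0.
Proof. by case: v => x y; congr (_, _); apply: addFF. Qed.

Lemma ev10_sat_inj (i j : 'I_51) : ev10 (sat i) = ev10 (sat j) -> i = j.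
Proof.
move=> e; have [si sj] := (size_sat (ltn_ord i), size_sat (ltn_ord j)).
have sij : size (sat i) = size (sat j) by rewrite si sj.
apply/sat_inj/bitxor_eq0 => //; rewrite si.
apply: ev10_eq0; first by rewrite size_bitxor si sj.
by rewrite ev10_xor // e addFFF.
Qed.

Lemma sat_pairsP p : p \in sat_pairs -> exists i j : 'I_51,
  p = (val i, val j) /\ sat_class i != sat_class j.
Proof.
rewrite mem_filter => /andP[cij /allpairsPdep[i [j [iI jI e]]]].
move: iI jI cij; rewrite !mem_iota e => /= i51 ji cij.
by exists (Ordinal i51), (Ordinal (ltn_trans ji i51)).
Qed.

Lemma ev10_sat_sum2 (i j : 'I_51) : ev10 (sat_sum2 (val i, val j)) = ev10 (sat i) + ev10 (sat j).
Proof. by rewrite /sat_sum2 /= ev10_xor ?size_sat ?ltn_ord. Qed.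

Lemma sat_sum12 (v : F * F) : v != 0 -> (exists i : 'I_51, ev10 (sat i) = v) \/
  exists i j : 'I_51, sat_class i != sat_class j /\ ev10 (sat i) + ev10 (sat j) = v.
Proof.
have [s [s10 <-]] := ev10_surj v.
have := covers_cubeP sat_sums12_sizes sat_sums12_full s10; rewrite inE => /predU1P[-> /eqP[]|].
  by rewrite /ev10 take_nseq // drop_nseq /ev5 !bitcomb_nseq0.
rewrite mem_cat => /orP[/mapP[i]|/mapP[p]].
  by rewrite mem_iota => /= i51 -> _; left; exists (Ordinal i51).
by case/sat_pairsP=> [i [j [-> cij]]] -> _; right; exists i, j; rewrite ev10_sat_sum2.
Qed.

Lemma sat_sum23 (v : F * F) :
  (exists i j : 'I_51, sat_class i != sat_class j /\ ev10 (sat i) + ev10 (sat j) = v) \/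
  exists i j k : 'I_51, [/\ sat_class i != sat_class j, sat_class i != sat_class k,
    sat_class j != sat_class k & ev10 (sat i) + ev10 (sat j) + ev10 (sat k) = v].
Proof.
have [s [s10 <-]] := ev10_surj v.
have := covers_cubeP sat_sums23_sizes sat_sums23_full s10.
rewrite mem_cat => /orP[/mapP[p]|/mapP[t]].
  by case/sat_pairsP=> [i [j [-> cij]]] ->; left; exists i, j; rewrite ev10_sat_sum2.
rewrite mem_filter => /andP[/andP[cik cjk] /allpairsPdep[p [k []]]].
case/sat_pairsP=> [i [j [-> cij]]] kI tE; rewrite {}tE /= in cik cjk * => ->.
have k51 : (k < 51)%N by move: kI; rewrite !inE => /orP[]/eqP->.
right; exists i, j, (Ordinal k51); split=> //=.
rewrite ev10_xor ?ev10_sat_sum2 // (size_sat k51).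
by rewrite size_bitxor !size_sat ?ltn_ord.
Qed.

Lemma sat_slope (j : 'I_23) : exists (k : 'I_51) (x : F), x != 0 /\
  ev10 (sat k) = (x, w ^+ j * x).
Proof.
have jI : val j \in iota 0 23 by rewrite mem_iota ltn_ord.
have /allP/(_ _ jI)/hasP[k] := sat_slopes.
rewrite mem_iota => /= k51 /andP[k0 /eqP kE].
have t5 : size (take 5 (sat k)) = 5 by rewrite size_take (size_sat k51).
exists (Ordinal k51), (ev5 (take 5 (sat k))); split.
  by apply: contraNneq k0 => /(ev5_eq0 t5) ->.
by rewrite /ev10 /= kE; have [_ ->] := ev5_iter_mulw j t5.
Qed.

Let expw_neq (i j : 'I_23) : i != j -> w ^+ i != w ^+ j.
Proof.
by rewrite (eq_prim_root_expr quintic_prim_root) !modn_small //;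
   apply: ltn_trans (ltn_ord _) _.
Qed.

(** The blocks {1}, {w} and the rest make every nonzero scalar a sum across two blocks: z = 1 + (1 +
    z) for z different from 1, and 1 = w + (w + 1). Numbering continues after the 23 Golay
    classes. *)
Definition scalar_class (z : F) : nat := if z == 1 then 23 else if z == w then 24 else 25.

Lemma scalar_split (z : F) : z != 0 -> exists x y : F,
  [/\ x != 0, y != 0, x + y = z & scalar_class x != scalar_class y].
Proof.
move=> z0.
have add_neq0 (x y : F) : (x + y == 0) = (x == y).
  by rewrite -(inj_eq (addIr y)) -addrA addFF addr0 add0r.
have addK (x y : F) : x + (x + y) = y by rewrite addrA addFF add0r.
have add1 (x : F) : (1 + x == 1) = (x == 0) by rewrite -(inj_eq (addrI 1)) addK addFF.
have w1 := negPf w_neq1; have w0 := negPf w_neq0.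
have c1 : scalar_class 1 = 23 by rewrite /scalar_class eqxx.
have [->|z1] := eqVneq z 1.
  exists w, (w + 1); rewrite w_neq0 add_neq0 w_neq1 addK; split=> //.
  by rewrite /scalar_class w1 eqxx addrC add1 w0 -subr_eq0 addrK oner_eq0.
exists 1, (1 + z); rewrite oner_neq0 add_neq0 eq_sym z1 addK; split=> //.
by rewrite c1 /scalar_class add1 (negPf z0); case: ifP.
Qed.

Definition base_class (i : base_index) : nat :=
  match i with
  | inl (j, _) => j
  | inr (inl z) => scalar_class (val z)
  | inr (inr k) => 26 + sat_class k
  end.

Lemma card_base_index : #|{: base_index}| = 818.
Proof. by rewrite !card_sum card_prod !card_ord card_sig cardC1 cardF. Qed.

Lemma scalar_class_bounds z : (23 <= scalar_class z < 26)%N.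
Proof. by rewrite /scalar_class; do 2?case: ifP. Qed.

(** The count is 23 Golay classes, 3 scalar classes and 21 classes of [sat] columns. *)
Lemma base_class_lt i : (base_class i < 47)%N.
Proof.
case: i => [[j x]|[z|k]] /=; first by apply: leq_trans (ltn_ord j) _.
  by have /andP[_ /leq_trans->] := scalar_class_bounds (val z).
rewrite /sat_class; have := ltn_ord k; case: ifP => k40 k51; last by lia.
have : (k %/ 8 < 5)%N by rewrite ltn_divLR.
by case: (_ != _) => /=; lia.
Qed.

Let class_block_scalar (j : 'I_23) z : nat_of_ord j != scalar_class z.
Proof. by have := ltn_ord j; have := scalar_class_bounds z; lia. Qed.

Let class_block_sat (j : 'I_23) k : nat_of_ord j != (26 + sat_class k)%N.
Proof. by have := ltn_ord j; lia. Qed.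

Let class_sat_scalar k z : (26 + sat_class k)%N != scalar_class z.
Proof. by have := scalar_class_bounds z; lia. Qed.

(** The cases follow the number of Golay columns needed for the first coordinate; the fewer there
    are, the more columns remain to correct [u] and [r]. *)
Lemma base_covering : proper_covering base_col base_class.
Proof.
split.
- move=> [[j x]|[z|k]] [[j' x']|[z'|k']] //=.
  + by case=> /golay_vec_inj -> ->.
  + by case=> /eqP; rewrite (negPf (golay_vec_neq0 _)).
  + by case=> /eqP; rewrite (negPf (golay_vec_neq0 _)).
  + by case=> /esym/eqP; rewrite (negPf (golay_vec_neq0 _)).
  + by case=> /val_inj ->.
  + by case=> _ _ e; case/eqP: (valP z).
  + by case=> /esym/eqP; rewrite (negPf (golay_vec_neq0 _)).
  + by case=> _ _ e; case/eqP: (valP z').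
  + by case=> e1 e2; congr (inr (inr _)); apply: ev10_sat_inj; rewrite /ev10 e1 e2.
- move=> [[j x]|[[z z0]|k]] /=.
  + by apply: contraNneq (golay_vec_neq0 j) => -[->].
  + by apply: contraNneq z0 => -[->].
  + by apply: contraNneq (ev10_sat_neq0 k) => -[e1 e2]; rewrite /ev10 e1 e2.
move=> [s [u r]].
pose Z (z : F) (z0 : z != 0) : base_index := inr (inl (exist (fun z => z != 0) z z0)).
pose B j x : base_index := inl (j, x); pose C k : base_index := inr (inr k).
case: (golay_cases s) => [->|[i ->]|[i [j [ij ->]]]|[i [j [k [ij ik jk ->]]]]].
(* No Golay column: [sat] columns produce [u] and scalar columns produce [r]. *)
- have [->|r0] := eqVneq r 0.
    have [[i [j [cij <-]]]|[i [j [k [cij cik cjk <-]]]]] := sat_sum23 u.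
      left; exists (C i), (C j); rewrite /= eqn_add2l; split=> //.
      by congr (_, (_, _)); rewrite /= addr0.
    right; exists (C i), (C j), (C k); rewrite /= !eqn_add2l; split=> //.
    by congr (_, (_, _)); rewrite /= ?addr0.
  have [->|u0] := eqVneq u 0.
    have [x [y [x0 y0 <- cxy]]] := scalar_split r0.
    by left; exists (Z x x0), (Z y y0); split=> //; congr (_, (_, _)); rewrite /= addr0.
  have [[i <-]|[i [j [cij <-]]]] := sat_sum12 u0.
    left; exists (C i), (Z r r0); split=> //=.
    by congr (_, (_, _)); rewrite /= ?addr0 ?add0r.
  right; exists (C i), (C j), (Z r r0); rewrite /= eqn_add2l; split=> //.
  by congr (_, (_, _)); rewrite /= ?addr0 ?add0r.
- pose b := w ^+ i; have b0 : b ^+ 2 != 0 by rewrite !expf_neq0.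
  (* This [x] settles the last coordinate, leaving the error in [u] to one or two [sat] columns. *)
  pose x := r / b ^+ 2; have bx : b ^+ 2 * x = r by rewrite mulrC divfK.
  have [ux|] := eqVneq (u - (x, b * x)) 0.
    (* With no error left, shift [x] by [y]: the [sat] column cancels (y, b y) and a scalar column
       cancels b^2 y. *)
    have [k [y [y0 yE]]] := sat_slope i.
    have z0 : b ^+ 2 * y != 0 by rewrite mulf_neq0.
    right; exists (B i (x + y)), (C k), (Z _ z0); split=> //=.
    rewrite yE -/b; move/eqP: ux; rewrite subr_eq0 => /eqP ->.
    congr (_, ((_, _), _)); rewrite /= ?addr0 //.
    + by rewrite -addrA addFF addr0.
    + by rewrite mulrDr -addrA addFF addr0.
    + by rewrite mulrDr bx -addrA addFF addr0.
  case/sat_sum12=> [[k kE]|[k [l [ckl klE]]]].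
    left; exists (B i x), (C k); split=> //=; rewrite kE -/b.
    by congr (_, (_, _)); rewrite /= ?addr0 // addrC subrK.
  right; exists (B i x), (C k), (C l); rewrite /= eqn_add2l; split=> //=.
  congr (_, (_, _)); rewrite /= ?addr0 // -addrA klE -/b.
  by rewrite addrC subrK.
- case: u => u1 u2; have [x [y [e1 e2]]] := vandermonde2 u1 u2 (expw_neq ij).
  have [e3|] := eqVneq r ((w ^+ i) ^+ 2 * x + (w ^+ j) ^+ 2 * y).
    by left; exists (B i x), (B j y); split=> //; rewrite /= -e1 -e2 e3.
  rewrite -subr_eq0 => z0; right; exists (B i x), (B j y), (Z _ z0); split=> //=.
  by rewrite -e1 -e2; congr (_, ((_, _), _)); rewrite /= ?addr0 // addrC subrK.
- case: u => u1 u2.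
  have [x [y [z [e1 e2 e3]]]] := vandermonde3 u1 u2 r (expw_neq ij) (expw_neq ik) (expw_neq jk).
  by right; exists (B i x), (B j y), (B k z); split=> //; rewrite /= -e1 -e2 -e3.
Qed.

End BaseCode.

(** * Lengths and densities *)

Lemma code_of_covering (V : zmodType) (I : finType) (K : eqType) (h : I -> V) (c : I -> K) r n :
  additive_bijection V 'cV[F2]_r -> #|I| = n -> proper_covering h c ->
  (n.+1 ^ 2 < 2 ^ r)%N -> exists H : 'M[F2]_(r, n), is_code_param H 3 3 2.
Proof.
move=> [f [fD bijf]] cardI cov small.
have bijI : bijective (fun i : 'I_n => enum_val (cast_ord (esym cardI) i)).
  exists (fun i => cast_ord cardI (enum_rank i)) => i.
    by rewrite enum_valK cast_ordKV.
  by rewrite cast_ordK enum_rankK.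
exact: code_covering (proper_covering_comp fD bijf (proper_covering_reindex bijI cov)) small.
Qed.

Lemma additive_bijection_refl (V : zmodType) : additive_bijection V V.
Proof. by exists id; split=> //; exists id. Qed.

(** Since 819 < 2^10, it is enough that 20 + 2k < 26 + 3k. *)
Lemma code_size_bound k : ((819 * 2 ^ k) ^ 2 < 2 ^ (26 + 3 * k))%N.
Proof.
apply: (@leq_ltn_trans ((2 ^ 10 * 2 ^ k) ^ 2)); first by rewrite leq_exp2r // leq_pmul2r ?expn_gt0.
by rewrite -expnD -expnM ltn_exp2l //; lia.
Qed.

Lemma exists_codes t : (t = 9 \/ 15 <= t)%N ->
  exists H : 'M[F2]_(3 * t - 1, 819 * 2 ^ (t - 9) - 1), is_code_param H 3 3 2.
Proof.
move=> tP.
have [F _ cardF] := pPrimePowerField (isT : prime 2) (isT : (0 < 5)%N).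
have [w w5] := exists_root_quintic cardF.
have iF := additive_bijection_finField cardF.
have baseI := additive_bijection_prod (additive_bijection_refl 'cV['F_2]_11)
  (additive_bijection_prod (additive_bijection_prod iF iF) iF).
have covB := base_covering cardF w5.
have small : ((819 * 2 ^ (t - 9) - 1).+1 ^ 2 < 2 ^ (3 * t - 1))%N.
  have := code_size_bound (t - 9); have := expn_gt0 2 (t - 9).
  have -> : (26 + 3 * (t - 9) = 3 * t - 1)%N by lia.
  by move=> p0; have -> : ((819 * 2 ^ (t - 9) - 1).+1 = 819 * 2 ^ (t - 9))%N by lia.
case: tP => [tE|t15].
  apply: code_of_covering covB small; last first.
    by rewrite card_base_index // tE.
  by have -> : (3 * t - 1 = 11 + (5 + 5 + 5))%N by rewrite tE.
have [E _ oE] := pPrimePowerField (isT : prime 2) (ltac:(lia) : (0 < t - 9)%N).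
have iE := additive_bijection_finField oE.
(* Class numbers become elements of [E] by position; they stay distinct because 47 <= 2^6 <= #|E|,
   which is where t >= 15 enters. *)
pose b i := nth 0 (enum E) (base_class w i).
have cE : (47 <= size (enum E))%N.
  rewrite -cardE oE; apply: (@leq_trans (2 ^ 6)) => //.
  by rewrite leq_exp2l //; lia.
have b_inj i j : b i = b j -> base_class w i = base_class w j.
  move/eqP; rewrite nth_uniq ?enum_uniq //; first by move/eqP.
    by apply: leq_trans cE; apply: base_class_lt.
  by apply: leq_trans cE; apply: base_class_lt.
have covE := qm_covering (proper_covering_refine b_inj covB).
apply: code_of_covering covE small; last first.
  (* The length is 818 * 2^m + (2^m - 1) with m = t - 9. *)
  rewrite card_qm_index card_base_index // oE.
  by have := expn_gt0 2 (t - 9); lia.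
have -> : (3 * t - 1 = 11 + (5 + 5 + 5) + ((t - 9) + ((t - 9) + (t - 9))))%N by lia.
exact: additive_bijection_prod baseI (additive_bijection_prod iE (additive_bijection_prod iE iE)).
Qed.

(** * Covering densities *)

Lemma natr_bin_sum4 (K : realType) n : (\sum_(i < 4) 'C(n, i))%:R =
  1 + n%:R + n%:R * (n%:R - 1) / 2 + n%:R * (n%:R - 1) * (n%:R - 2) / 6 :> K.
Proof.
have bin2 m : 'C(m, 2)%:R = m%:R * (m%:R - 1) / 2 :> K.
  elim: m => [|m IH]; first by rewrite bin_small // mul0r mul0r.
  by rewrite binS natrD IH bin1 -natr1; field.
have bin3 m : 'C(m, 3)%:R = m%:R * (m%:R - 1) * (m%:R - 2) / 6 :> K.
  elim: m => [|m IH]; first by rewrite bin_small // !mul0r.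
  by rewrite binS natrD IH bin2 -natr1; field.
by rewrite !big_ord_recl big_ord0 /= bin0 bin1 !natrD bin2 bin3 addr0 !addrA.
Qed.

(** With N = n + 1 = 819 * 2^k the binomial sum is N^3/6 - N^2/2 + 4N/3; division by 2^(26 + 3k)
    leaves a polynomial in u = 2^(-k), whose limit is read off at u = 0. *)
Lemma density_code (K : realType) k (u := (2^-1) ^+ k : K) :
  density3 K (819 * 2 ^ k - 1) (3 * (k + 9) - 1) =
  (819 ^+ 3 / 6 + u * (1092 * u - 819 ^+ 2 / 2)) / 2 ^+ 26.
Proof.
rewrite /density3 natr_bin_sum4 natrB ?muln_gt0 ?expn_gt0 // natrM.
have -> : (3 * (k + 9) - 1 = 26 + k * 3)%N by lia.
rewrite expnD expnM !natrM !natrX.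
have y0 : (2 ^+ k : K) != 0 by rewrite expf_neq0 // pnatr_eq0.
have -> : u = (2 ^+ k)^-1 by rewrite /u exprVn.
by field.
Qed.

Import numFieldNormedType.Exports.
Local Open Scope classical_set_scope.

Lemma density_limit (K : realType) :
  (fun t : nat => density3 K (819 * 2 ^ (t - 9) - 1)%N (3 * t - 1)%N)
       @ \oo --> ((819%:R ^+ 3 / (3%:R * 2%:R ^+ 27)) : K)%R.
Proof.
pose P (u : K) := (819 ^+ 3 / 6 + u * (1092 * u - 819 ^+ 2 / 2)) / 2 ^+ 26.
have u0 : (fun k => (2^-1) ^+ k : K) @ \oo --> (0 : K).
  by apply: cvg_expr; rewrite ger0_norm ?invr_ge0 ?ler0n // invf_lt1 ?ltr0n // ltr1n.
have cC a : (fun=> a : K) @ \oo --> (a : K) by apply: cvg_cst.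
have lim : (fun k => P ((2^-1) ^+ k)) @ \oo --> P 0.
  exact: cvgM (cvgD (cC _) (cvgM u0 (cvgB (cvgM (cC _) u0) (cC _)))) (cC _).
(* Starting at t = 9 removes the truncation in t - 9. *)
rewrite -(cvg_shiftn 9) /=.
have -> : (fun k => density3 K (819 * 2 ^ (k + 9 - 9) - 1)%N (3 * (k + 9) - 1)%N) =
    (fun k => P ((2^-1) ^+ k)).
  by apply/funext => k; rewrite addnK density_code.
have P0 : P 0 = 819%:R ^+ 3 / (3%:R * 2%:R ^+ 27) by rewrite /P; field.
by rewrite P0 in lim.
Qed.

Theorem theorem7p6 :
  (forall t : nat, (t = 9 \/ 15 <= t)%N ->
     let r := (3 * t - 1)%N in
     let n := (819 * 2 ^ (t - 9) - 1)%N in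
     (exists H : 'M[F2]_(r, n), is_code_param H 3 3 2) /\
     (forall m : nat, is_l2 r 3 m -> (m <= n)%N)) /\
  (forall K : realType,
     (fun t : nat => density3 K (819 * 2 ^ (t - 9) - 1)%N (3 * t - 1)%N)
       @ \oo --> ((819%:R ^+ 3 / (3%:R * 2%:R ^+ 27)) : K)%R).
Proof.
split; last exact: density_limit.
move=> t tP r n; have [H codeH] := exists_codes tP.
split; first by exists H.
by move=> m [_]; apply; exists H; case: codeH.
Qed.
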